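(* Let $\mathscr{L}$ be a bounded distributive lattice, let $S \subseteq \mathscr{L}$ be $\vee$-closed, and let $F$ be a filter of $\mathscr{L}$ such that $F \cap S = \varnothing$. Then there exists an $S$-filter $\mathfrak{q}$ of $\mathscr{L}$ such that $F \subseteq \mathfrak{q}$.
   Context: A bounded lattice has a least element $0$ and a greatest element $1$. A filter of $\mathscr{L}$ is a non-empty subset $F \subseteq \mathscr{L}$ such that $u \wedge v \in F$ for all $u,v \in F$, and $u \in F$, $w \in \mathscr{L}$, $u \le w$ imply $w \in F$; it is proper if $F \ne \mathscr{L}$. A subset $S \subseteq \mathscr{L}$ is $\vee$-closed if $0 \in S$ and $s_1 \vee s_2 \in S$ for all $s_1,s_2 \in S$. For a $\vee$-closed $S$, a proper filter $\mathfrak{q}$ of $\mathscr{L}$ is an $S$-filter if for all $u,v \in \mathscr{L}$, $u \vee v \in \mathfrak{q}$ and $u \in S$ imply $v \in \mathfrak{q}$. *)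

(* Defs.v *)
From mathcomp Require Import all_boot all_order.
From mathcomp Require Import classical_sets.

Set Implicit Arguments.
Unset Strict Implicit.
Unset Printing Implicit Defensive.

Local Open Scope classical_set_scope.

Definition lattice_filter (d : Order.disp_t) (L : tbDistrLatticeType d)
    (F : set L) : Prop :=
  [/\ F !=set0,
      forall u v : L, F u -> F v -> F (u `&` v)%O
    & forall u w : L, F u -> (u <= w)%O -> F w].

Definition proper_filter (d : Order.disp_t) (L : tbDistrLatticeType d)
    (F : set L) : Prop :=
  lattice_filter F /\ F <> [set: L].

Definition vee_closed (d : Order.disp_t) (L : tbDistrLatticeType d)
    (S : set L) : Prop :=
  S \bot%O /\ forall s1 s2 : L, S s1 -> S s2 -> S (s1 `|` s2)%O.

(* Meaningful for join-closed S only; that hypothesis is left to the user. *)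
Definition S_filter (d : Order.disp_t) (L : tbDistrLatticeType d)
    (S q : set L) : Prop :=
  proper_filter q /\
  forall u v : L, q (u `|` v)%O -> S u -> q v.

(* Main.v *)
Require Import Defs.
From mathcomp Require Import all_boot all_order.
From mathcomp Require Import classical_sets.

(** The smallest candidate works, without any maximality argument: an
    [S]-filter containing [F] must contain every [v] such that [s `|` v]
    lies in [F] for some [s] in [S], and these elements already form an
    [S]-filter.  This set is the lattice analogue of the saturation (or
    localization) of an ideal at a multiplicatively closed set.  Distributivity
    makes it closed under meets ([saturation_filter]), closure of [S] under
    joins makes the cancellation property hold ([saturation_cancel]), and
    disjointness of [F] and [S] keeps [\bot] out of it
    ([saturation_bot]). *)

Set Implicit Arguments.
Unset Strict Implicit.
Unset Printing Implicit Defensive.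

Import Order.TTheory.

Local Open Scope classical_set_scope.

Definition saturation (d : Order.disp_t) (L : tbDistrLatticeType d)
    (S F : set L) : set L :=
  [set v | exists2 s, S s & F (s `|` v)%O].

Lemma sub_saturation (d : Order.disp_t) (L : tbDistrLatticeType d)
    (S F : set L) : S \bot%O -> F `<=` saturation S F.
Proof. by move=> S0 v Fv; exists \bot%O; rewrite ?join0x. Qed.

(** For meets, witnesses [s] of [u] and [t] of [v] are replaced by the common
    witness [s `|` t], over which join distributes. *)
Lemma saturation_filter (d : Order.disp_t) (L : tbDistrLatticeType d)
    (S F : set L) :
  vee_closed S -> lattice_filter F -> lattice_filter (saturation S F).
Proof.
move=> [S0 SU] [[x Fx] FI Fup]; split.
- by exists x; apply: sub_saturation.
- move=> u v [s Ss Fsu] [t St Ftv]; exists (s `|` t)%O; first exact: SU.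
  rewrite joinIr; apply: FI.
  + by apply: Fup Fsu _; rewrite leU2 ?leUl.
  + by apply: Fup Ftv _; rewrite leU2 ?leUr.
- move=> u w [s Ss Fsu] le_uw; exists s => //.
  by apply: Fup Fsu _; rewrite leU2.
Qed.

Lemma saturation_bot (d : Order.disp_t) (L : tbDistrLatticeType d)
    (S F : set L) : F `&` S = set0 -> ~ saturation S F \bot%O.
Proof.
move=> FS0 [s Ss]; rewrite joinx0 => Fs.
by have : (F `&` S) s by []; rewrite FS0.
Qed.

(** An element of [S] joined to [v] can be absorbed into the witness. *)
Lemma saturation_cancel (d : Order.disp_t) (L : tbDistrLatticeType d)
    (S F : set L) (u v : L) :
  vee_closed S -> saturation S F (u `|` v)%O -> S u -> saturation S F v.
Proof.
move=> [_ SU] [s Ss Fsuv] Su.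
by exists (s `|` u)%O; [exact: SU | rewrite -joinA].
Qed.

Theorem theorem3p10 (d : Order.disp_t) (L : tbDistrLatticeType d)
    (S F : set L) (hS : vee_closed S) (hF : lattice_filter F)
    (hFS : F `&` S = set0) :
  exists q : set L, S_filter S q /\ F `<=` q.
Proof.
exists (saturation S F); split; last exact: sub_saturation hS.1.
split; last by move=> u v; apply: saturation_cancel.
split; first exact: saturation_filter.
by move=> qT; apply: (saturation_bot hFS); rewrite qT.
Qed.
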